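(* Let $n\ge1$. For each $a\in\{1,2,4\}$ let $\tau_a$ denote the transposition of $\{1,2,4\}$ which fixes $a$ and swaps the other two digits, acting linearly on $\mathcal A_n$. Suppose that $X,Y\in\mathcal A_n$ satisfy $$\tau_p(X)=X,\qquad \tau_q(Y)=Y$$ for some $p,q\in\{1,2,4\}$. Then, for any $r\in\{1,2,4\}$, the product $XY$ is symmetric with respect to the $r$-axis, that is $\tau_r(XY)=XY$, if and only if $$XY=(\tau_r\tau_q)(Y)\,(\tau_r\tau_p)(X).$$
   Context: $\Delta_n=\{1,2,4,7\}^n$ is the set of words of length $n$. Digits are identified with quaternionic symbols: $1=i$, $2=j$, $4=k$, $7=e$, where $e$ is the identity, $i^2=j^2=k^2=-e$, $ij=k=-ji$, $jk=i=-kj$, $ki=j=-ik$. Words are multiplied coordinate by coordinate, with the local quaternionic signs collected into one global sign. $\mathcal A_n$ is the real algebra with basis $\Delta_n$ and product extended bilinearly (so $\mathcal A_n\cong\mathbb H^{\otimes n}$). A permutation $\pi$ of $\{1,2,4\}$ acts on $\Delta_n$ by permuting the digits $1,2,4$ in each position and fixing $7$; the same symbol denotes its linear extension to $\mathcal A_n$. Products such as $\tau_r\tau_q$ are compositions. *)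

(* Defs.v *)
From HB Require Import structures.
From mathcomp Require Import all_boot all_order all_algebra all_fingroup.
From mathcomp Require Import reals.

Set Implicit Arguments.
Unset Strict Implicit.
Unset Printing Implicit Defensive.

Import GRing.Theory.
Local Open Scope ring_scope.

(* Ax1, Ax2, Ax4 are the digits 1 = i, 2 = j, 4 = k. *)
Inductive axis : Type := Ax1 | Ax2 | Ax4.

Definition axis_code (a : axis) : option bool :=
  match a with Ax1 => None | Ax2 => Some false | Ax4 => Some true end.
Definition axis_decode (c : option bool) : axis :=
  match c with None => Ax1 | Some false => Ax2 | Some true => Ax4 end.
Lemma axis_codeK : cancel axis_code axis_decode.
Proof. by case. Qed.

HB.instance Definition _ := Finite.copy axis (can_type axis_codeK).

(* {1,2,4,7}: Some a is the digit of the axis a, and None is 7 = e. *)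
Definition digit : Type := option axis.
HB.instance Definition _ := Finite.on digit.

Definition word (n : nat) : Type := {ffun 'I_n -> digit}.
HB.instance Definition _ (n : nat) := Finite.on (word n).

(* The boolean is true when the product carries a minus sign:
   ij = k = -ji, jk = i = -kj, ki = j = -ik, i^2 = j^2 = k^2 = -e. *)
Definition digit_mul (d d' : digit) : bool * digit :=
  match d, d' with
  | None, _ => (false, d')
  | _, None => (false, d)
  | Some Ax1, Some Ax1 | Some Ax2, Some Ax2 | Some Ax4, Some Ax4 => (true, None)
  | Some Ax1, Some Ax2 => (false, Some Ax4)
  | Some Ax2, Some Ax1 => (true, Some Ax4)
  | Some Ax2, Some Ax4 => (false, Some Ax1)
  | Some Ax4, Some Ax2 => (true, Some Ax1)
  | Some Ax4, Some Ax1 => (false, Some Ax2)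
  | Some Ax1, Some Ax4 => (true, Some Ax2)
  end.

Definition word_mul (n : nat) (u v : word n) : word n :=
  [ffun i => (digit_mul (u i) (v i)).2].

Definition word_sign (R : comNzRingType) (n : nat) (u v : word n) : R :=
  \prod_(i < n) (-1) ^+ (digit_mul (u i) (v i)).1.

Definition word1 (n : nat) : word n := [ffun=> None].

(* An element is its family of coordinates in the basis of words.  The alias
   keeps the algebra structure below apart from the pointwise product that the
   library puts on finite functions. *)
Definition qalg (R : comNzRingType) (n : nat) : Type := {ffun word n -> R^o}.
HB.instance Definition _ (R : comNzRingType) (n : nat) :=
  GRing.Lmodule.copy (qalg R n) {ffun word n -> R^o}.

Definition qbasis (R : comNzRingType) (n : nat) (u : word n) : qalg R n :=
  [ffun v => (v == u)%:R].

Definition qmul (R : comNzRingType) (n : nat) (X Y : qalg R n) : qalg R n :=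
  \sum_(u : word n) \sum_(v : word n)
    (X u * Y v * word_sign R u v) *: qbasis R (word_mul u v).

Section Algebra.
Variables (R : comNzRingType) (n : nat).
Implicit Types (u v w : word n) (X Y Z : qalg R n) (c : R).
Local Notation b := (qbasis R).
Local Notation sg := (word_sign R).

Lemma qalgDE X Y u : (X + Y) u = X u + Y u.
Proof. exact: ffunE. Qed.

Lemma qalgZE c X u : (c *: X) u = c * X u.
Proof. exact: ffunE. Qed.

Lemma qalg_sumE (I : Type) (r : seq I) (P : pred I) (F : I -> qalg R n) u :
  (\sum_(i <- r | P i) F i) u = \sum_(i <- r | P i) F i u.
Proof. exact: sum_ffunE. Qed.

Lemma qbasisE u v : b u v = (v == u)%:R.
Proof. exact: ffunE. Qed.

Lemma qalg_decomp X : X = \sum_u X u *: b u.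
Proof.
apply/ffunP => w; rewrite qalg_sumE (bigD1 w) //= big1 => [|u uw].
  by rewrite qalgZE qbasisE eqxx mulr1 addr0.
by rewrite qalgZE qbasisE eq_sym (negbTE uw) mulr0.
Qed.

Lemma qmulDl : left_distributive (@qmul R n) +%R.
Proof.
move=> X Y Z; rewrite /qmul -big_split; apply: eq_bigr => u _.
rewrite -big_split; apply: eq_bigr => v _.
by rewrite qalgDE !mulrDl scalerDl.
Qed.

Lemma qmulDr : right_distributive (@qmul R n) +%R.
Proof.
move=> X Y Z; rewrite /qmul -big_split; apply: eq_bigr => u _.
rewrite -big_split; apply: eq_bigr => v _.
by rewrite qalgDE mulrDr mulrDl scalerDl.
Qed.

Lemma qmulZl c X Y : c *: qmul X Y = qmul (c *: X) Y.
Proof.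
rewrite /qmul scaler_sumr; apply: eq_bigr => u _.
rewrite scaler_sumr; apply: eq_bigr => v _.
by rewrite qalgZE scalerA !mulrA.
Qed.

Lemma qmulZr c X Y : c *: qmul X Y = qmul X (c *: Y).
Proof.
rewrite /qmul scaler_sumr; apply: eq_bigr => u _.
rewrite scaler_sumr; apply: eq_bigr => v _.
by rewrite qalgZE scalerA !mulrA (mulrC c).
Qed.

Lemma qmul0l X : qmul 0 X = 0.
Proof. by apply: (addrI (qmul 0 X)); rewrite -qmulDl !addr0. Qed.

Lemma qmul0r X : qmul X 0 = 0.
Proof. by apply: (addrI (qmul X 0)); rewrite -qmulDr !addr0. Qed.

Lemma qmul_suml (I : Type) (r : seq I) (F : I -> qalg R n) Y :
  qmul (\sum_(i <- r) F i) Y = \sum_(i <- r) qmul (F i) Y.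
Proof.
elim: r => [|i r IHr]; first by rewrite !big_nil qmul0l.
by rewrite !big_cons qmulDl IHr.
Qed.

Lemma qmul_sumr (I : Type) (r : seq I) (F : I -> qalg R n) X :
  qmul X (\sum_(i <- r) F i) = \sum_(i <- r) qmul X (F i).
Proof.
elim: r => [|i r IHr]; first by rewrite !big_nil qmul0r.
by rewrite !big_cons qmulDr IHr.
Qed.

Lemma qmul_basis u v : qmul (b u) (b v) = sg u v *: b (word_mul u v).
Proof.
rewrite /qmul (bigD1 u) //= [X in _ + X]big1 => [|u' /negbTE uu'].
  rewrite addr0 (bigD1 v) //= big1 => [|v' /negbTE vv'].
    by rewrite !qbasisE !eqxx !mul1r addr0.
  by rewrite !qbasisE vv' mulr0 mul0r scale0r.
by rewrite big1 // => v' _; rewrite !qbasisE uu' !mul0r scale0r.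
Qed.

Lemma word_mulA : associative (@word_mul n).
Proof.
move=> u v w; apply/ffunP => i; rewrite !ffunE.
by case: (u i) (v i) (w i) => [[]|] [[]|] [[]|].
Qed.

Lemma word_signA u v w :
  sg v w * sg u (word_mul v w) = sg u v * sg (word_mul u v) w.
Proof.
rewrite /word_sign -!big_split; apply: eq_bigr => i _ /=; rewrite !ffunE.
case: (u i) (v i) (w i) => [[]|] [[]|] [[]|] /=;
  by rewrite ?(expr0, expr1, mulr1, mul1r, mulrNN).
Qed.

Lemma qmulA : associative (@qmul R n).
Proof.
have basisA u v w : qmul (b u) (qmul (b v) (b w)) = qmul (qmul (b u) (b v)) (b w).
  by rewrite !qmul_basis -qmulZr -qmulZl !qmul_basis !scalerA word_signA word_mulA.
have basisA2 u v Z : qmul (b u) (qmul (b v) Z) = qmul (qmul (b u) (b v)) Z.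
  rewrite (qalg_decomp Z) (qmul_sumr _ _ (b v)).
  rewrite (qmul_sumr _ _ (b u)) (qmul_sumr _ _ (qmul _ _)); apply: eq_bigr => w _.
  by rewrite -!qmulZr basisA.
have basisA1 u Y Z : qmul (b u) (qmul Y Z) = qmul (qmul (b u) Y) Z.
  rewrite (qalg_decomp Y) (qmul_suml _ _ Z) (qmul_sumr _ _ (b u)).
  rewrite (qmul_sumr _ _ (b u)) (qmul_suml _ _ Z).
  by apply: eq_bigr => v _; rewrite -qmulZl -!qmulZr -qmulZl basisA2.
move=> X Y Z; rewrite (qalg_decomp X) (qmul_suml _ _ (qmul Y Z)) (qmul_suml _ _ Y).
rewrite (qmul_suml _ _ Z); apply: eq_bigr => u _.
by rewrite -!qmulZl basisA1.
Qed.

Lemma qmul1l : left_id (b (word1 n)) (@qmul R n).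
Proof.
move=> X; rewrite [X]qalg_decomp qmul_sumr; apply: eq_bigr => u _.
rewrite -qmulZr qmul_basis /word_sign big1 => [|i _]; last by rewrite ffunE.
by rewrite scale1r; congr (_ *: b _); apply/ffunP => i; rewrite !ffunE.
Qed.

Lemma qmul1r : right_id (b (word1 n)) (@qmul R n).
Proof.
move=> X; rewrite [X]qalg_decomp qmul_suml; apply: eq_bigr => u _.
rewrite -qmulZl qmul_basis /word_sign big1 => [|i _]; last first.
  by rewrite ffunE; case: (u i) => [[]|].
rewrite scale1r; congr (_ *: b _); apply/ffunP => i; rewrite !ffunE.
by case: (u i) => [[]|].
Qed.

Lemma qone_neq0 : b (word1 n) != 0.
Proof.
apply/eqP => /ffunP /(_ (word1 n)); rewrite !ffunE eqxx => /eqP.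
by rewrite oner_eq0.
Qed.

End Algebra.

HB.instance Definition _ (R : comNzRingType) (n : nat) :=
  GRing.Zmodule_isNzRing.Build (qalg R n) (@qmulA R n) (@qmul1l R n)
    (@qmul1r R n) (@qmulDl R n) (@qmulDr R n) (@qone_neq0 R n).
HB.instance Definition _ (R : comNzRingType) (n : nat) :=
  GRing.Lmodule_isLalgebra.Build R (qalg R n) (@qmulZl R n).
HB.instance Definition _ (R : comNzRingType) (n : nat) :=
  GRing.Lalgebra_isAlgebra.Build R (qalg R n) (@qmulZr R n).

Definition word_perm (n : nat) (s : {perm axis}) (u : word n) : word n :=
  [ffun i => omap s (u i)].

Definition qperm (R : comNzRingType) (n : nat) (s : {perm axis})
    (X : qalg R n) : qalg R n :=
  \sum_(u : word n) X u *: qbasis R (word_perm s u).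

Lemma qperm_is_linear (R : comNzRingType) (n : nat) (s : {perm axis}) :
  linear (@qperm R n s).
Proof.
move=> c X Y; rewrite /qperm scaler_sumr -big_split; apply: eq_bigr => u _.
by rewrite qalgDE qalgZE scalerDl scalerA.
Qed.

HB.instance Definition _ (R : comNzRingType) (n : nat) (s : {perm axis}) :=
  GRing.isLinear.Build R (qalg R n) (qalg R n) _ (@qperm R n s)
    (@qperm_is_linear R n s).

(* The transposition that fixes a. *)
Definition tau (a : axis) : {perm axis} :=
  match a with
  | Ax1 => tperm Ax2 Ax4
  | Ax2 => tperm Ax1 Ax4
  | Ax4 => tperm Ax1 Ax2
  end.

(* Main.v *)
(** Swapping two of the imaginary units [i], [j], [k] reverses the cyclic order
    of the three, so it is an anti-automorphism of the quaternions, and hence of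
    their tensor power.  Thus [tau r (X Y) = tau r Y * tau r X], and the
    invariance of [X] and [Y] lets one insert [tau p] and [tau q]. *)
Require Import Defs.
From mathcomp Require Import all_boot all_order all_algebra all_fingroup.
From mathcomp Require Import reals.
Import GRing.Theory.
Local Open Scope ring_scope.

Lemma tauE (a b : axis) :
  tau a b = match a, b with
            | Ax1, Ax2 => Ax4 | Ax1, Ax4 => Ax2
            | Ax2, Ax1 => Ax4 | Ax2, Ax4 => Ax1
            | Ax4, Ax1 => Ax2 | Ax4, Ax2 => Ax1
            | _, _ => b
            end.
Proof. by case: a b => [] []; rewrite /= ?tpermL ?tpermR ?tpermD. Qed.

(** Exchanging two units reverses the cycle [i], [j], [k], and swapping the factors reverses it
    back, so no sign is lost. Squares and products with [e] do not depend on the order. *)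
Lemma digit_mul_tau (a : axis) (d d' : digit) :
  digit_mul (omap (tau a) d') (omap (tau a) d) =
  ((digit_mul d d').1, omap (tau a) (digit_mul d d').2).
Proof. by case: d d' => [[]|] [[]|]; rewrite /= ?tauE; case: a. Qed.

Lemma word_mul_tau (n : nat) (a : axis) (u v : word n) :
  word_mul (word_perm (tau a) v) (word_perm (tau a) u) =
  word_perm (tau a) (word_mul u v).
Proof. by apply/ffunP => i; rewrite !ffunE digit_mul_tau. Qed.

Lemma word_sign_tau (R : comNzRingType) (n : nat) (a : axis) (u v : word n) :
  word_sign R (word_perm (tau a) v) (word_perm (tau a) u) = word_sign R u v.
Proof. by apply: eq_bigr => i _; rewrite !ffunE digit_mul_tau. Qed.

Lemma qperm_basis (R : comNzRingType) (n : nat) (s : {perm axis}) (u : word n) :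
  qperm s (qbasis R u) = qbasis R (word_perm s u).
Proof.
rewrite /qperm (bigD1 u) //= big1 => [|v /negbTE vu].
  by rewrite qbasisE eqxx scale1r addr0.
by rewrite qbasisE vu scale0r.
Qed.

Lemma qperm_tauM (R : comNzRingType) (n : nat) (a : axis) (X Y : qalg R n) :
  qperm (tau a) (X * Y) = qperm (tau a) Y * qperm (tau a) X.
Proof.
rewrite {1}[X]qalg_decomp {1}[Y]qalg_decomp big_distrlr /= {2 3}/qperm.
(* On the right the words of [Y] form the outer sum; the exchange aligns the two double sums,
   reducing the claim to basis words. *)
rewrite big_distrlr exchange_big linear_sum /=.
apply: eq_bigr => v _; rewrite linear_sum /=; apply: eq_bigr => u _.
rewrite -!scalerAl -!scalerAr !linearZ /= !scalerA; congr (_ *: _).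
rewrite [qbasis R u * _]qmul_basis [RHS]qmul_basis linearZ /= qperm_basis.
by rewrite word_mul_tau word_sign_tau.
Qed.

Theorem proposition5p2 (R : realType) (n : nat) (hn : (1 <= n)%N)
    (X Y : qalg R n) (p q : axis)
    (hX : qperm (tau p) X = X) (hY : qperm (tau q) Y = Y) (r : axis) :
  qperm (tau r) (X * Y) = X * Y <->
  X * Y = (qperm (tau r) \o qperm (tau q)) Y * (qperm (tau r) \o qperm (tau p)) X.
(* Once [tau p] and [tau q] are absorbed, the right-hand product is [qperm (tau r) (X * Y)], so both
   sides state one equation, read in opposite directions. *)
Proof. by rewrite /= hX hY -qperm_tauM; split=> /esym. Qed.
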